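(* Let $k\ge 2$ be an integer, let $q$ be an odd prime, and let $\mathcal{G}=\langle r,s : s^{2}=r^{2^kq}=e,\ srs^{-1}=r^{2^{k-1}q-1}\rangle$. Let $\delta_1$ denote the largest eigenvalue of the signless Laplacian matrix $Q(P(\mathcal{G}))$ of the power graph $P(\mathcal{G})$. Then $$\frac{2^{k}(2q-1)+n_2}{2}\ \le\ \delta_1\ \le\ 2^{k-1}q+2+\sqrt{2^{2k-2}q^2+2^{k}q}+\sqrt{4+2^{k-1}q}+\frac{3\cdot 2^{k}q-6+n_3}{2},$$ where $n_2=\sqrt{2^{2k}(4q^2-4q+1)+2^{k+2}(q-1)+8}$ and $n_3=\sqrt{(2^{k}q)^2-2^{k+2}+12}$.
   Context: The power graph $P(\Omega)$ of a group $\Omega$ is the simple graph with vertex set $\Omega$ in which two distinct elements $u,v$ are adjacent iff $u=v^m$ or $v=u^n$ for some positive integers $m,n$. The signless Laplacian matrix of a graph is $D+A$, with $D$ the diagonal degree matrix and $A$ the adjacency matrix. *)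

(* Defs.v *)
From mathcomp Require Import all_boot all_order all_algebra all_fingroup.
From mathcomp Require Import boolp.

Set Implicit Arguments.
Unset Strict Implicit.
Unset Printing Implicit Defensive.

Import Order.TTheory GRing.Theory Num.Theory.

(* The power graph of the group [gT], as the adjacency relation of a simple
   graph whose vertices are all the elements of [gT]. *)
Definition power_graph (gT : finGroupType) : rel gT := fun u v =>
  (u != v) && `[< (exists m : nat, 0 < m /\ u = (v ^+ m)%g) \/
                  (exists n : nat, 0 < n /\ v = (u ^+ n)%g) >].
Arguments power_graph : clear implicits.

Local Open Scope ring_scope.

(* Matrices of a graph on the finite type [T] with adjacency relation [e]; the
   i-th row and column correspond to the vertex [enum_val i]. *)
Section GraphMatrices.
Variables (R : pzRingType) (T : finType) (e : rel T).

Definition degree (x : T) : nat := #|[set y | e x y]|.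

Definition adjacency_mx : 'M[R]_#|T| :=
  \matrix_(i, j) (e (enum_val i) (enum_val j))%:R.

Definition degree_mx : 'M[R]_#|T| :=
  diag_mx (\row_i (degree (enum_val i))%:R).

Definition signless_laplacian_mx : 'M[R]_#|T| := degree_mx + adjacency_mx.

End GraphMatrices.
Arguments adjacency_mx R {T} e.
Arguments degree_mx R {T} e.
Arguments signless_laplacian_mx R {T} e.

Definition largest_eigenvalue (R : realFieldType) (n : nat) (A : 'M[R]_n)
    (a : R) : Prop :=
  eigenvalue A a /\ (forall b : R, eigenvalue A b -> b <= a).

(* Main.v *)
Require Import Defs.
From mathcomp Require Import all_boot all_order all_algebra all_fingroup.
From mathcomp Require Import cyclic extremal boolp complex zify ring lra.

(** Put h = 2^(k-1) q, so that the rotation r has order 2h, the group has order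
    4h, and s r s^-1 = r^(h-1) with h even.

    Lower bound.  The identity is adjacent to the 4h - 1 other vertices, and
    the largest signless Laplacian eigenvalue of a graph is at least
    1 + its largest degree: this is the Rayleigh quotient of the vector that is
    an eigenvector for the star around the vertex of that degree
    ([degree_lt_largest_eigenvalue]).  Hence delta1 >= 4h, and an elementary
    estimate puts the stated lower bound below 4h.

    That argument uses two facts.  The Rayleigh quotients of a symmetric matrix
    over a real closed field R are bounded by its largest eigenvalue
    ([rayleigh_le]), by the unitary diagonalization over R[i].  The group
    really has 4h elements ([presented_card_ge]), because the semidirect product
    of cyclic groups of orders 2h and 2 satisfies the relations; the action is
    an involution as (h-1)^2 = 1 modulo 2h.

    Upper bound.  If A has nonnegative entries, w is a positive vector and
    A w <= c w, then no eigenvalue exceeds c ([eigenvalue_le_of_weight]).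
    Only the identity and the central involution z = r^h can have a large
    degree.  An element outside <r> has its square in {1, z}, so it
    generates a group of order at most 4, which contains all its neighbours; and
    an element of <r> other than 1 and z has all its neighbours in <r>.  With
    weight 2 on {1, z} and weight 1 elsewhere, c = 6h works
    ([eigenvalue_le_of_hubs]), and the stated upper bound is at least 6h. *)

Set Implicit Arguments.
Unset Strict Implicit.
Unset Printing Implicit Defensive.

Import Order.TTheory GRing.Theory Num.Theory.

(** * Power graph of the presented group *)

Lemma power_graphE (gT : finGroupType) (u v : gT) :
  power_graph gT u v =
    (u != v) && ((u \in <[v]>%g) || (v \in <[u]>%g)).
Proof.
have pow_cycle (x y : gT) :
    (exists m : nat, (0 < m)%N /\ x = (y ^+ m)%g) <-> x \in <[y]>%g.
  split=> [[m [_ ->]]|/cyclePmin[[|m] _ ->]]; first exact: mem_cycle.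
    by exists #[y]%g; rewrite order_gt0 expg_order.
  by exists m.+1.
rewrite /power_graph; congr (_ && _); apply/asboolP/orP.
  by case=> /pow_cycle; [left | right].
by case=> /pow_cycle; [left | right].
Qed.

Section PresentedGroup.
Local Open Scope group_scope.

(** Relations only bound the order of a group from above; the lower bound needs
    a model.  The semidirect product of 'Z_n by 'Z_2, whose generator acts as
    x |-> x^t, satisfies the relations, hence is a quotient of the group. *)
Lemma presented_card_ge (gT : finGroupType) (n t : nat) : (1 < n)%N ->
  (t * t = 1 %[mod n])%N ->
  [set: gT] \isog Grp (r : s : s ^+ 2 = r ^+ n = 1, s * r * s^-1 = r ^+ t) ->
  (2 * n <= #|gT|)%N.
Proof.
move=> n_gt1 tt iso.
pose b : 'Z_n := Zp1.
have ob : #[b] = n by rewrite order_Zp1 Zp_cast.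
have tt_expg x : x \in <[b]> -> x ^+ (t * t) = x.
  move=> bx; apply/eqP; rewrite -{2}[x]expg1 eq_expg_mod_order.
  have ox : #[x] %| n by have := order_dvdG bx; rewrite /= -orderE ob.
  by rewrite -(modn_dvdm _ ox) tt modn_dvdm.
have inj_f : 'injm (cyclem t b).
  apply/subsetP=> x /setIdP[bx]; rewrite !inE => /eqP xt1.
  have := congr1 (fun y => y ^+ t) xt1; rewrite /cyclem expg1n -expgM.
  by rewrite (tt_expg _ bx) => ->.
have im_f : cyclem t b @* <[b]> = <[b]>.
  apply/morphim_fixP => //.
  by rewrite morphim_cycle ?cycle_id ?cycleX.
(* The power map by t is its own inverse on <[b]>, which makes it an
   automorphism of order dividing 2. *)
pose a := aut inj_f im_f.
have aE x : x \in <[b]> -> a x = x ^+ t by move=> bx; rewrite autE.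
have aA : a \in Aut <[b]> by exact: Aut_aut.
have a2 : a ^+ 2 = 1.
  apply: (eq_Aut (groupX 2 aA) (group1 _)) => x bx.
  rewrite perm1 expgS expg1 permM !aE ?groupX // -expgM.
  exact: tt_expg.
have /isoGrp_hom modelG : [set: Extremal.gtype n 2 t] \isog
    Grp (x : y : x ^+ n, y ^+ 2, x ^ y = x ^+ t).
  apply: Extremal.Grp => //; exists a.
  split=> //; last by rewrite aE ?cycle_id.
  by rewrite order_dvdn a2.
have : [set: Extremal.gtype n 2 t] \homg [set: gT].
  rewrite iso; case/existsP: modelG => -[x y] /= /eqP[genG xn y2 xy].
  apply/existsP; exists (x, y); rewrite /= !xpair_eqE genG xn y2 !eqxx /=.
  have yV : y^-1 = y by apply/eqP; rewrite eq_invg_mul -expg2 y2.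
  by rewrite -xy conjgE yV mulgA.
by move/leq_homg; rewrite Extremal.card // cardsT.
Qed.

Variables (gT : finGroupType) (h : nat) (r s : gT).
Hypotheses (h_gt1 : (1 < h)%N) (s2 : s ^+ 2 = 1) (rn : r ^+ (2 * h) = 1).
Hypotheses (srs : s * r * s^-1 = r ^+ (h - 1)).
Hypotheses (gen : <[r]> <*> <[s]> = [set: gT]).

Lemma s_inv : s^-1 = s.
Proof. by apply/eqP; rewrite eq_invg_mul -expg2 s2. Qed.

Lemma rh_sqr : (r ^+ h) ^+ 2 = 1.
Proof. by rewrite -expgM mulnC. Qed.

Lemma presented_mulG : <[r]> * <[s]> = [set: gT].
Proof.
rewrite -gen norm_joinEr // cycle_subG -groupV; apply/normP/eqP.
by rewrite eqEcard cardJg leqnn andbT -cycleJ cycle_subG conjgE invgK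
  mulgA srs mem_cycle.
Qed.

Lemma presented_order_r : (#[r] <= 2 * h)%N.
Proof. by rewrite dvdn_leq ?order_dvdn ?rn //; lia. Qed.

Lemma presented_card_le : (#|gT| <= 2 * (2 * h))%N.
Proof.
have os : (#[s] <= 2)%N by rewrite dvdn_leq // order_dvdn s2.
rewrite -cardsT -presented_mulG.
apply: leq_trans (_ : #|<[r]>| * #|<[s]>| <= _)%N.
  by rewrite mul_cardG leq_pmulr // cardG_gt0.
by rewrite [leqRHS]mulnC leq_mul // presented_order_r.
Qed.

(** (r^i s)^2 = r^i (s r^i s^-1) = r^(i + (h-1) i) = (r^h)^i, and r^h is an
    involution or 1. *)
Lemma sqr_notin_cycle (y : gT) : y \notin <[r]> -> y ^+ 2 = 1 \/ y ^+ 2 = r ^+ h.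
Proof.
have : y \in <[r]> * <[s]> by rewrite presented_mulG inE.
case/mulsgP => _ _ /cycleP[i ->] /cycleP[j ->] ->.
rewrite -(odd_double_half j) -mul2n expgD expgM s2 expg1n mulg1.
case: (odd j); last by rewrite mulg1 mem_cycle.
move=> _; have -> : (r ^+ i * s ^+ true) ^+ 2 = (r ^+ h) ^+ i.
  rewrite expg1 expg2 -mulgA (mulgA s) -{2}s_inv.
  have -> : s * r ^+ i * s^-1 = (r ^+ i) ^ s^-1 by rewrite conjgE invgK mulgA.
  rewrite conjXg conjgE invgK mulgA srs -!expgM -expgD.
  by congr (r ^+ _); nia.
rewrite -(odd_double_half i) -mul2n expgD expgM rh_sqr expg1n mulg1.
by case: (odd i); [right; rewrite expg1 | left].
Qed.

(** Such a y has order dividing 4. *)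
Lemma cycle_expg_odd_notin (y : gT) (m : nat) : y \notin <[r]> -> odd m ->
  <[y ^+ m]> = <[y]>.
Proof.
move=> /sqr_notin_cycle y2 om; apply/esym/eqP.
rewrite -[_ == _]/(generator _ _) generator_coprime.
have oy : #[y] %| 2 ^ 2.
  rewrite order_dvdn (expgM y 2 2); case: y2 => ->; rewrite ?expg1n //.
  by rewrite rh_sqr.
by rewrite (coprime_dvdl oy) // coprimeXl // coprime2n.
Qed.

Lemma expg_even_notin_cycle (y : gT) (m : nat) : y \notin <[r]> -> ~~ odd m ->
  y ^+ m = 1 \/ y ^+ m = r ^+ h.
Proof.
move=> yr em; rewrite -(odd_double_half m) (negbTE em) add0n -mul2n expgM.
case: (sqr_notin_cycle yr) => ->; first by left; rewrite expg1n.
rewrite -(odd_double_half m./2) -mul2n expgD expgM rh_sqr expg1n mulg1.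
by case: (odd _); [right; rewrite expg1 | left].
Qed.

(** If x = y^m then m is odd, since the even powers of y lie in <r>; so
    y generates <x>, and every neighbour of x lies in this group of order at
    most 4. *)
Lemma degree_notin_cycle (x : gT) : x \notin <[r]> ->
  (degree (power_graph gT) x <= 2 * h - 1)%N.
Proof.
move=> xr; apply: leq_trans (_ : #|<[x]> :\ x| <= _)%N.
  apply/subset_leq_card/subsetP => y; rewrite !inE power_graphE eq_sym.
  case/andP=> -> /= /orP[|//] /cycleP[m xE]; rewrite xE.
  have yr : y \notin <[r]>.
    by apply: contra xr; rewrite xE; apply: groupX.
  have [om|em] := boolP (odd m); first by rewrite cycle_expg_odd_notin ?cycle_id.
  case/negP: xr; rewrite xE.
  by case: (expg_even_notin_cycle yr em) => ->; rewrite ?group1 ?mem_cycle.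
have -> : #|<[x]> :\ x| = (#[x] - 1)%N.
  by rewrite orderE (cardsD1 x <[x]>) cycle_id addKn.
have : (#[x] <= 4)%N.
  rewrite dvdn_leq // order_dvdn (expgM x 2 2).
  case: (sqr_notin_cycle xr) => ->; rewrite ?expg1n //.
  by rewrite rh_sqr.
by lia.
Qed.

(** If y is a neighbour of x outside <r>, then x is a power of y, and an even
    one since the odd powers of y generate <y>, so lie outside <r>; but the even
    powers of y belong to {1, r^h}. *)
Lemma degree_in_cycle (x : gT) : x \in <[r]> -> x != 1 -> x != r ^+ h ->
  (degree (power_graph gT) x <= 2 * h - 1)%N.
Proof.
move=> xr x1 xz; apply: leq_trans (_ : #|<[r]> :\ x| <= _)%N.
  apply/subset_leq_card/subsetP => y; rewrite !inE power_graphE eq_sym.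
  case/andP=> -> /= xy; apply: contraT => yr.
  case/orP: xy => [/cycleP[m xE]|yx]; last first.
    by case/negP: yr; apply: subsetP yx; rewrite cycle_subG.
  have [om|em] := boolP (odd m).
    case/negP: (yr); apply: (subsetP (_ : <[x]> \subset <[r]>)).
      by rewrite cycle_subG.
    by rewrite xE cycle_expg_odd_notin ?cycle_id.
  by case: (expg_even_notin_cycle yr em) => xE'; rewrite xE xE' eqxx in x1 xz.
have -> : #|<[r]> :\ x| = (#[r] - 1)%N.
  by rewrite orderE (cardsD1 x <[r]>) xr addKn.
exact: leq_sub2r presented_order_r.
Qed.

End PresentedGroup.

Local Open Scope ring_scope.

(** * Eigenvalue estimates for matrices *)

(** The easy half of the Collatz-Wielandt formula: pair the inequality
    |b| |v| <= |v| A, valid for a left eigenvector v, with the weight w. *)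
Lemma eigenvalue_le_of_weight (R : realFieldType) (n : nat) (A : 'M[R]_n)
    (w : 'I_n -> R) (c b : R) :
  (forall i j, 0 <= A i j) -> (forall i, 0 < w i) ->
  (forall i, \sum_j A i j * w j <= c * w i) ->
  eigenvalue A b -> b <= c.
Proof.
move=> A0 w0 Aw /eigenvalueP[v vA vn0].
have [j vj] : exists j, v 0 j != 0 by apply/rV0Pn.
have S0 : 0 < \sum_i `|v 0 i| * w i.
  rewrite (bigD1 j) //= ltr_pwDl ?mulr_gt0 ?normr_gt0 //.
  by apply: sumr_ge0 => i _; rewrite mulr_ge0 // ltW.
rewrite -(ler_pM2r S0) !mulr_sumr.
apply: le_trans (_ : \sum_i `|v 0 i| * \sum_j A i j * w j <= _); last first.
  by apply: ler_sum => i _; rewrite mulrCA ler_wpM2l.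
under [leRHS]eq_bigr => i _ do rewrite mulr_sumr.
rewrite exchange_big /=; apply: ler_sum => i _.
under eq_bigr => l _ do rewrite mulrA.
rewrite -mulr_suml mulrA; apply: ler_wpM2r; first exact: ltW.
apply: le_trans (_ : `|b * v 0 i| <= _).
  by rewrite normrM ler_wpM2r // ler_norm.
move/rowP/(_ i): vA; rewrite !mxE => <-.
apply: le_trans (ler_norm_sum _ _ _) _.
by apply: ler_sum => l _; rewrite normrM (ger0_norm (A0 _ _)).
Qed.

Section Rayleigh.
Local Open Scope sesquilinear_scope.

(** Seen over the algebraically closed field R[i], A is hermitian, hence
    unitarily diagonalizable with a real spectrum; the bound d on the
    eigenvalues in R therefore controls the whole spectrum. *)
Lemma rayleigh_le (R : rcfType) (n : nat) (A : 'M[R]_n) (d : R) (u : 'rV_n) :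
  A^T = A -> largest_eigenvalue A d ->
  (u *m A *m u^T) 0 0 <= d * (u *m u^T) 0 0.
Proof.
move=> As [_ dmax].
pose f := real_complex R; pose B := map_mx f A.
have fconj (x : R) : (f x)^* = f x.
  by apply: conj_Creal; apply/complex_realP; exists x.
have Bh : B \is hermsymmx.
  apply: realsym_hermsym.
    by apply/is_hermitianmxP; rewrite scale1r map_mx_id // map_trmx As.
  by apply/mxOverP => i j; rewrite mxE; apply/complex_realP; exists (A i j).
have /orthomx_spectralP := hermitian_normalmx Bh.
have := hermitian_spectral_diag_real Bh.
have := spectral_unitarymx B.
move: (spectralmx B) (spectral_diag B) => P D Pu Dr BE.
(* The rows of P are eigenvectors; an eigenvalue of B that is the image of
   an element of R is already an eigenvalue of A. *)
have Dle i : D 0 i <= f d.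
  have [x Dx] : exists x, D 0 i = f x.
    by have /complex_realP[x Dx] := mxOverP Dr 0 i; exists x.
  rewrite Dx lecR; apply: dmax.
  rewrite -(eigenvalue_map f) -/B; apply/eigenvalueP; exists (row i P).
    transitivity (D 0 i *: row i P); last by rewrite Dx.
    rewrite {1}BE !mulmxA -row_mul mulmxV ?unitarymx_unit //.
    by rewrite row1 -rowE row_diag_mx -scalemxAl -rowE.
  apply/eqP => Pi0; have := unitarymx_unit Pu.
  have /unitarymxP/row_matrixP/(_ i) := Pu.
  rewrite row_mul Pi0 mul0mx row1 => /rowP/(_ i); rewrite !mxE !eqxx => /eqP.
  by rewrite eq_sym oner_eq0.
pose uC := map_mx f u.
have uCt : uC ^t* = map_mx f u^T.
  by apply/matrixP => i j; rewrite !mxE fconj.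
rewrite -lecR rmorphM /=.
have -> : ((u *m A *m u^T) 0 0)%:C%C = (uC *m B *m uC ^t*) 0 0.
  by rewrite uCt -!map_mxM [RHS]mxE.
have -> : ((u *m u^T) 0 0)%:C%C = (uC *m uC ^t*) 0 0.
  by rewrite uCt -map_mxM [RHS]mxE.
(* In the coordinates y of u in the orthonormal eigenbasis both sides become
   sums of |y_i|^2, weighted by the eigenvalues on the left. *)
pose y := uC *m P ^t*.
have yt : y ^t* = P *m uC ^t* by rewrite trmx_mul map_mxM trmxCK.
have -> : uC *m uC ^t* = y *m y ^t*.
  by rewrite yt mulmxA mulmxKtV.
have -> : uC *m B *m uC ^t* = y *m diag_mx D *m y ^t*.
  by rewrite yt BE invmx_unitary // !mulmxA.
rewrite !mxE mulr_sumr; apply: ler_sum => i _.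
rewrite mul_mx_diag !mxE mulrAC mulrC ler_wpM2r //.
by rewrite -normCK exprn_ge0.
Qed.

End Rayleigh.

(** * Signless Laplacian of a graph *)

Section Graph.
Variables (R : rcfType) (T : finType) (e : rel T).

Lemma sum_enum_val (F : T -> R) : \sum_(i < #|T|) F (enum_val i) = \sum_x F x.
Proof. by rewrite -big_enum_val. Qed.

Lemma signless_laplacian_row (w : T -> R) i :
  \sum_j signless_laplacian_mx R e i j * w (enum_val j)
    = (degree e (enum_val i))%:R * w (enum_val i) + \sum_(y | e (enum_val i) y) w y.
Proof.
under eq_bigr => j _ do rewrite !mxE mulrDl.
rewrite big_split /=; congr (_ + _).
  rewrite (bigD1 i) //= eqxx mulr1n big1 ?addr0 // => j ji.
  by rewrite eq_sym (negbTE ji) mulr0n mul0r.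
rewrite (sum_enum_val (fun y => (e (enum_val i) y)%:R * w y)) [RHS]big_mkcond.
by apply: eq_bigr => y _; case: (e _ y); rewrite ?mul1r ?mul0r.
Qed.

Lemma degree_sum1 x : (degree e x)%:R = \sum_(y | e x y) (1 : R).
Proof. by rewrite sumr_const /degree cardsE. Qed.

(** The test vector is the Perron vector of the star formed by x0 and its
    neighbours: the degree at x0, and 1 at each neighbour.  Edges outside the
    star can only increase its Rayleigh quotient. *)
Lemma degree_lt_largest_eigenvalue d x0 :
  symmetric e -> irreflexive e -> (0 < degree e x0)%N ->
  largest_eigenvalue (signless_laplacian_mx R e) d ->
  (degree e x0).+1%:R <= d.
Proof.
move=> esym eirr D0 dmax; set D : R := (degree e x0)%:R.
pose w x : R := if x == x0 then D else (e x0 x)%:R.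
have w0 x : 0 <= w x by rewrite /w; case: ifP => _; exact: ler0n.
have Qsym : (signless_laplacian_mx R e)^T = signless_laplacian_mx R e.
  apply/matrixP => i j; rewrite !mxE esym eq_sym.
  by case: eqP => [->|].
pose u := \row_(i < #|T|) w (enum_val i).
have := rayleigh_le u Qsym dmax.
have -> : (u *m u^T) 0 0 = \sum_x w x * w x.
  rewrite -(sum_enum_val (fun x => w x * w x)) mxE.
  by apply: eq_bigr => i _; rewrite !mxE.
have -> : (u *m signless_laplacian_mx R e *m u^T) 0 0
    = \sum_x w x * ((degree e x)%:R * w x + \sum_(y | e x y) w y).
  rewrite -(sum_enum_val (fun x => w x * (_ * w x + \sum_(y | e x y) w y))).
  rewrite -mulmxA mxE; apply: eq_bigr => i _; rewrite -signless_laplacian_row.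
  by rewrite !mxE; congr (_ * _); apply: eq_bigr => j _; rewrite !mxE.
move=> rayleigh.
have D_gt0 : 0 < D by rewrite ltr0n.
have ww_gt0 : 0 < \sum_x w x * w x.
  rewrite (bigD1 x0) //= ltr_pwDl //; first by rewrite /w eqxx mulr_gt0.
  by apply: sumr_ge0 => x _; rewrite mulr_ge0.
rewrite -(ler_pM2r ww_gt0); apply: le_trans rayleigh.
rewrite mulr_sumr; apply: ler_sum => x _; rewrite mulrCA ler_wpM2l //.
have [->|x_x0] := eqVneq x x0.
  have -> : \sum_(y | e x0 y) w y = D.
    rewrite /D degree_sum1; apply: eq_bigr => y xy; rewrite /w xy.
    by case: eqP xy => // ->; rewrite eirr.
  by rewrite /w eqxx -/D -natr1 mulrDl mul1r.
have [x0x|x0x] := boolP (e x0 x); last first.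
  rewrite {1 2}/w (negbTE x_x0) (negbTE x0x) !mulr0 add0r.
  exact: sumr_ge0.
rewrite {1 2}/w (negbTE x_x0) x0x !mulr1 -natr1 addrC -/D.
apply: lerD.
  by rewrite ler1n card_gt0; apply/set0Pn; exists x0; rewrite inE esym.
(* The edge from x to x0 alone contributes D. *)
rewrite (bigD1 x0) ?[e x x0]esym //= {1}/w eqxx lerDl.
exact: sumr_ge0.
Qed.

(** Weight 2 on S and 1 elsewhere: the neighbours of x weigh at most
    degree x + 2, so the row of x is bounded by 2 (degree x) + 2 <= 2n off S,
    and by 3 (degree x) + 2 < 6n on S. *)
Lemma eigenvalue_le_of_hubs (S : {set T}) (n : nat) (b : R) :
  (#|S| <= 2)%N -> (forall x, (degree e x < 2 * n)%N) ->
  (forall x, x \notin S -> (degree e x < n)%N) ->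
  eigenvalue (signless_laplacian_mx R e) b -> b <= (3 * n)%:R.
Proof.
move=> S2 deg2n degn; pose w x : R := 1 + (x \in S)%:R.
apply: (eigenvalue_le_of_weight (w := w \o enum_val)) => [i j|i|i] /=.
- by rewrite !mxE addr_ge0 // mulrn_wge0.
- by rewrite ltr_pwDl.
rewrite signless_laplacian_row; move: (enum_val i) => x.
have : \sum_(y | e x y) w y <= (degree e x)%:R + 2.
  rewrite big_split /= -degree_sum1 lerD2l.
  apply: le_trans (_ : #|S|%:R <= _); last by rewrite ler_nat.
  rewrite -sum1_card natr_sum [leRHS]big_mkcond [leLHS]big_mkcond /=.
  by apply: ler_sum => y _; do 2!case: ifP.
move=> sum_le; apply: le_trans (lerD (lexx _) sum_le) _.
rewrite /w; have [xS|xS] := boolP (x \in S).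
  by rewrite -(natrD _ 1 1) -!natrM -!natrD ler_nat; have := deg2n x; lia.
by rewrite addr0 !mulr1 -!natrD ler_nat; have := degn x xS; lia.
Qed.

End Graph.

(** * Numerical comparison *)

Lemma ler_sqrt_sqr (R : rcfType) (x y : R) : 0 <= x -> x ^+ 2 <= y ->
  x <= Num.sqrt y.
Proof. by move=> x0 xy; rewrite -(ger0_norm x0) -sqrtr_sqr ler_wsqrtr. Qed.

(** With a = 2^k and S = a (2q - 1), this says that the square root is at most
    4 a q - S = a (2q + 1). *)
Lemma lower_bound_numeric (R : rcfType) (a q : R) : 4 <= a -> 3 <= q ->
  (a * (2 * q - 1)
   + Num.sqrt (a ^+ 2 * (4 * q ^+ 2 - 4 * q + 1) + 4 * a * (q - 1) + 8)) / 2
  <= 2 * (a * q).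
Proof.
move=> a4 q3.
have : Num.sqrt (a ^+ 2 * (4 * q ^+ 2 - 4 * q + 1) + 4 * a * (q - 1) + 8)
    <= a * (2 * q + 1).
  rewrite -[leRHS]ger0_norm; last by nra.
  rewrite -sqrtr_sqr ler_wsqrtr //.
  have aq : 12 <= a * q by nra.
  have aaq : 4 * (a * q) <= a * (a * q) by rewrite ler_wpM2r //; lra.
  by nra.
lra.
Qed.

(** With a = 2^k, the three square roots are at least a q / 2, 2 and a q - 2;
    for these values the right-hand side is exactly 3 a q. *)
Lemma upper_bound_numeric (R : rcfType) (a q : R) : 4 <= a -> 3 <= q ->
  3 * (a * q) <= a / 2 * q + 2 + Num.sqrt (a ^+ 2 / 4 * q ^+ 2 + a * q)
    + Num.sqrt (4 + a / 2 * q)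
    + (3 * a * q - 6 + Num.sqrt ((a * q) ^+ 2 - 4 * a + 12)) / 2.
Proof.
move=> a4 q3.
have s1 : a * q / 2 <= Num.sqrt (a ^+ 2 / 4 * q ^+ 2 + a * q).
  by apply: ler_sqrt_sqr; nra.
have s2 : 2 <= Num.sqrt (4 + a / 2 * q).
  by apply: ler_sqrt_sqr; nra.
have s3 : a * q - 2 <= Num.sqrt ((a * q) ^+ 2 - 4 * a + 12).
  by apply: ler_sqrt_sqr; nra.
nra.
Qed.

(** * The spectral bounds *)

Theorem theorem5p4 (R : rcfType) (k q : nat) (gT : finGroupType) (delta1 : R)
    (k_ge2 : (2 <= k)%N) (q_prime : prime q) (q_odd : odd q)
    (presG : ([set: gT] \isog Grp (r : s :
       s ^+ 2 = r ^+ (2 ^ k * q) = 1,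
       s * r * s^-1 = r ^+ (2 ^ (k - 1) * q - 1)))%g)
    (delta1_max :
       largest_eigenvalue (signless_laplacian_mx R (power_graph gT)) delta1) :
  let n2 : R := Num.sqrt (2 ^+ (2 * k) * (4 * q%:R ^+ 2 - 4 * q%:R + 1)
                          + 2 ^+ (k + 2) * (q%:R - 1) + 8) in
  let n3 : R := Num.sqrt ((2 ^+ k * q%:R) ^+ 2 - 2 ^+ (k + 2) + 12) in
  (2 ^+ k * (2 * q%:R - 1) + n2) / 2 <= delta1
  /\ delta1 <= 2 ^+ (k - 1) * q%:R + 2
               + Num.sqrt (2 ^+ (2 * k - 2) * q%:R ^+ 2 + 2 ^+ k * q%:R)
               + Num.sqrt (4 + 2 ^+ (k - 1) * q%:R)
               + (3 * 2 ^+ k * q%:R - 6 + n3) / 2.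
Proof.
move=> n2 n3.
have [j kE] : exists j, k = j.+2 by exists (k - 2)%N; lia.
have q_ge3 : (3 <= q)%N by move: (prime_gt1 q_prime) q_odd; case: (q) => [|[|[]]].
pose h' := (2 ^ j * q)%N; pose h := (2 * h')%N.
have h'_gt0 : (0 < h')%N by rewrite muln_gt0 expn_gt0; lia.
have hE : (2 ^ (k - 1) * q = h)%N.
  by rewrite kE subn1 /= expnS -mulnA.
have nE : (2 ^ k * q = 2 * h)%N by rewrite -hE mulnA -expnS kE subn1.
have h_gt1 : (1 < h)%N by rewrite /h; lia.
rewrite hE nE in presG.
have tt : ((h - 1) * (h - 1) = 1 %[mod 2 * h])%N.
  have -> : ((h - 1) * (h - 1) = (h' - 1) * (2 * h) + 1)%N by rewrite /h; nia.
  by rewrite modnMDl.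
have card_ge : (2 * (2 * h) <= #|gT|)%N.
  by apply: presented_card_ge tt presG; lia.
have e_sym : symmetric (power_graph gT).
  by move=> x y; rewrite !power_graphE eq_sym orbC.
have e_irr : irreflexive (power_graph gT) by move=> x; rewrite power_graphE eqxx.
have deg1 : degree (power_graph gT) 1%g = #|gT|.-1.
  rewrite -(cardsC1 (1%g : gT)) /degree; apply: eq_card => x.
  by rewrite !inE power_graphE group1 andbT eq_sym.
have deg_lt x : (degree (power_graph gT) x < #|gT|)%N.
  rewrite -[ltnRHS]prednK -?cardsT ?cardG_gt0 // cardsT ltnS -(cardC1 x).
  apply: subset_leq_card; apply/subsetP => y; rewrite !inE.
  by apply: contraTneq => ->; rewrite e_irr.
(* The identity is a vertex of degree 4h - 1. *)
have delta_ge : (2 * (2 * h))%:R <= delta1.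
  apply: le_trans (degree_lt_largest_eigenvalue (x0 := 1%g) e_sym e_irr _ delta1_max).
    by rewrite ler_nat deg1; lia.
  by rewrite deg1; lia.
have delta_le : delta1 <= (3 * (2 * h))%:R.
  have /existsP[[r s] /= /eqP[gen s2 rn srs]] := isoGrp_hom presG.
  apply: (eigenvalue_le_of_hubs (S := [set 1%g; (r ^+ h)%g])) (delta1_max.1).
  - by rewrite cards2; case: (_ != _).
  - move=> x; apply: leq_trans (deg_lt x) _.
    exact: presented_card_le s2 rn srs gen.
  - move=> x; rewrite !inE negb_or => /andP[x1 xz].
    have hpos : (0 < 2 * h)%N by lia.
    rewrite -[ltnRHS](prednK hpos) ltnS -subn1.
    have [xr|xr] := boolP (x \in <[r]>%g); last exact: degree_notin_cycle srs gen _ xr.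
    exact: degree_in_cycle srs gen _ xr x1 xz.
pose a : R := 2 ^+ k.
have a_ge4 : 4 <= a.
  by rewrite /a -natrX ler_nat kE !expnS; have := expn_gt0 2 j; lia.
have q_ge3R : 3 <= q%:R :> R by rewrite ler_nat.
have hR : (2 * h)%:R = a * q%:R :> R by rewrite -nE natrM natrX.
have a2E : 2 ^+ (2 * k) = a ^+ 2 :> R by rewrite /a -exprM mulnC.
have a4E : 2 ^+ (k + 2) = 4 * a :> R by rewrite exprD -/a; ring.
have ahE : 2 ^+ (k - 1) = a / 2 :> R by rewrite /a kE subn1 /= !exprS; field.
have aqE : 2 ^+ (2 * k - 2) = a ^+ 2 / 4 :> R.
  have -> : (2 * k - 2 = (k - 1) * 2)%N by lia.
  by rewrite exprM ahE; field.
split.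
  apply: le_trans delta_ge; rewrite natrM hR /n2 a2E a4E -/a.
  exact: lower_bound_numeric.
apply: le_trans delta_le _; rewrite natrM hR /n3 ahE aqE a4E -/a.
exact: upper_bound_numeric.
Qed.
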